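(* Let $X$ be a locally compact abelian Polish group. Then a set $A\subseteq X$ is Haar meager if and only if $A$ is meager in $X$.
   Context: An abelian Polish group is an abelian topological group (written additively) whose topology is separable and completely metrizable. For $B\subseteq X$ and $x\in X$, $B+x=\{b+x : b\in B\}$. A subset of a topological space is meager in that space if it is a countable union of nowhere dense subsets of that space. A set $A\subseteq X$ is Haar meager if there exist a Borel set $B\subseteq X$ with $A\subseteq B$, a nonempty compact metric space $K$, and a continuous function $f:K\to X$ such that $f^{-1}(B+x)$ is meager in $K$ for every $x\in X$. *)

(* Defs.v *)
From HB Require Import structures.
From mathcomp Require Import all_boot all_order all_algebra.
From mathcomp Require Import all_classical all_reals all_analysis.

Set Implicit Arguments.
Unset Strict Implicit.
Unset Printing Implicit Defensive.

Import Order.TTheory GRing.Theory Num.Theory.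

Local Open Scope classical_set_scope.
Local Open Scope ring_scope.

Definition separable_space (T : topologicalType) : Prop :=
  exists D : set T, countable D /\ dense D.

Definition is_metric (R : realType) (T : Type) (d : T -> T -> R) : Prop :=
  [/\ forall x y, 0 <= d x y,
      forall x y, d x y = 0 <-> x = y,
      forall x y, d x y = d y x &
      forall x y z, d x z <= d x y + d y z].

Definition metric_induces_topology (R : realType) (T : topologicalType)
    (d : T -> T -> R) : Prop :=
  forall (x : T) (U : set T),
    nbhs x U <-> exists2 e : R, 0 < e & [set y | d x y < e] `<=` U.

Definition metric_complete (R : realType) (T : topologicalType)
    (d : T -> T -> R) : Prop :=
  forall u : nat -> T,
    (forall e : R, 0 < e -> exists N : nat,
       forall m n : nat, (N <= m)%N -> (N <= n)%N -> d (u m) (u n) < e) ->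
    exists l : T, u @ \oo --> l.

Definition completely_metrizable (R : realType) (T : topologicalType) : Prop :=
  exists d : T -> T -> R,
    [/\ is_metric d, metric_induces_topology d & metric_complete d].

Definition polish_space (R : realType) (T : topologicalType) : Prop :=
  separable_space T /\ completely_metrizable R T.

Definition nowhere_dense (T : topologicalType) (A : set T) : Prop :=
  (closure A)° = set0.

(* Sequences of sets suffice for countable unions, as set0 is nowhere dense. *)
Definition meager (T : topologicalType) (A : set T) : Prop :=
  exists2 F : nat -> set T,
    (forall n, nowhere_dense (F n)) & A = \bigcup_n F n.

Definition translate (X : zmodType) (B : set X) (x : X) : set X :=
  [set b + x | b in B].

Definition borel_set (T : topologicalType) (B : set T) : Prop := <<s open >> B.

Definition haar_meager (R : realType) (X : topologicalZmodType) (A : set X) :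
    Prop :=
  exists B : set X,
    [/\ borel_set B, A `<=` B &
      exists (K : metricType R) (f : K -> X),
        [/\ [set: K] !=set0, compact [set: K], continuous f &
            forall x : X, meager (f @^-1` (translate B x))]].

(* Main.v *)
From HB Require Import structures.
Require Import Defs.
From mathcomp Require Import all_boot all_order all_algebra.
From mathcomp Require Import all_classical all_reals all_analysis.

(** The backward implication is witnessed by inclusions of compact sets. A meager
    set A is covered by countably many closed nowhere dense sets C n, whose
    union is Borel; take for f the inclusion of the closure K of an open set
    that contains 0 and lies in a compact set. Translates of C n are again
    closed and nowhere dense, and because K is the closure of its interior,
    their traces on K stay nowhere dense in K ([nowhere_dense_metric_sub]).

    For the forward implication, let f : K -> X witness that the Borel set B is
    Haar meager. Since B has the Baire property, it agrees with an open set U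
    outside a union of closed nowhere dense sets C n. Suppose that U is
    nonempty. The idea is that of the Kuratowski-Ulam theorem for the set
    {(x, k) | f k - x \in C n}, but here one point suffices: fix a sequence k j
    dense in K. If f^-1 (C n + x) has nonempty interior in K, then it contains
    some k j, that is, x lies in f (k j) - C n. These countably many sets are
    nowhere dense, so by Baire's theorem in X some x lies outside all of them
    and in the nonempty open set f k0 - U. For this x, every f^-1 (C n + x) is
    nowhere dense in K, while f^-1 (U + x) is open and contains k0. As
    f^-1 (B + x) is meager, so is f^-1 (U + x), against Baire's theorem in K.
    Hence U is empty and B is meager.

    Both uses of Baire's theorem are covered by its version for locally compact
    Hausdorff spaces ([locally_compact_baire]). *)

Set Implicit Arguments.
Unset Strict Implicit.
Unset Printing Implicit Defensive.

Import Order.TTheory GRing.Theory Num.Theory.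

Local Open Scope classical_set_scope.
Local Open Scope ring_scope.

(** * Nowhere dense and meager sets *)

Lemma nowhere_denseS (T : topologicalType) (A B : set T) :
  A `<=` B -> nowhere_dense B -> nowhere_dense A.
Proof.
by move=> AB nB; rewrite /nowhere_dense -subset0 -nB; exact/interiorS/closureS.
Qed.

Lemma nowhere_dense_closure (T : topologicalType) (A : set T) :
  nowhere_dense A -> nowhere_dense (closure A).
Proof.
by rewrite /nowhere_dense -(closure_id (closure A)).1//; exact: closed_closure.
Qed.

Lemma closed_nowhere_dense (T : topologicalType) (C : set T) : closed C ->
  (forall W : set T, open W -> W !=set0 -> ~ W `<=` C) -> nowhere_dense C.
Proof.
move=> Ccl noW; rewrite /nowhere_dense -(closure_id C).1//.
rewrite -subset0 => x Cx.
apply: (noW C°) => //; [exact: open_interior|by exists x|exact: interior_subset].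
Qed.

Lemma nowhere_dense_open (T : topologicalType) (C W : set T) :
  nowhere_dense C -> open W -> W `<=` closure C -> W = set0.
Proof. by move=> nC oW WC; rewrite -subset0 -nC -open_subsetE. Qed.

Lemma meagerS (T : topologicalType) (A B : set T) :
  A `<=` B -> meager B -> meager A.
Proof.
move=> AB [F nF BE]; exists (fun n => F n `&` A).
  by move=> n; apply: nowhere_denseS (nF n); exact: subIsetl.
rewrite -setI_bigcupl -BE; apply/seteqP; split=> [x Ax|x []//].
by split => //; exact: AB.
Qed.

Lemma meager0 (T : topologicalType) : meager (@set0 T).
Proof.
exists (fun=> set0) => [_|]; last by rewrite bigcup0.
by rewrite /nowhere_dense closure0 interior0.
Qed.

Lemma nowhere_dense_meager (T : topologicalType) (A : set T) :
  nowhere_dense A -> meager A.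
Proof. by move=> nA; exists (fun=> A) => //; rewrite bigcup_const//; exists 0%N. Qed.

Lemma meager_bigcup (T : topologicalType) (A : nat -> set T) :
  (forall n, meager (A n)) -> meager (\bigcup_n A n).
Proof.
move=> mA.
have /choice[F FA] n : exists F : nat -> set T,
    (forall m, nowhere_dense (F m)) /\ A n = \bigcup_m F m.
  by have [F nF AE] := mA n; exists F.
pose G i := if @unpickle (nat * nat)%type i is Some p then F p.1 p.2 else set0.
exists G => [i|].
  rewrite /G; case: unpickle => [p|]; first by have [+ _] := FA p.1.
  by rewrite /nowhere_dense closure0 interior0.
apply/seteqP; split=> [x [n _]|x [i _]].
  have [_ ->] := FA n => -[m _ Fx].
  by exists (pickle (n, m)) => //; rewrite /G pickleK.
rewrite /G; case: unpickle => [[n m]/= Fx|//].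
by exists n => //; have [_ ->] := FA n; exists m.
Qed.

Lemma meagerU (T : topologicalType) (A B : set T) :
  meager A -> meager B -> meager (A `|` B).
Proof.
move=> mA mB; rewrite (_ : A `|` B =
    \bigcup_n (if n is 0%N then A else B)).
  by apply: meager_bigcup => -[|n].
apply/seteqP; split=> [x [Ax|Bx]|x [[|n] _ ?]]; [by exists 0%N|by exists 1%N|..].
- by left.
- by right.
Qed.

Lemma meager_subset_closed_cover (T : topologicalType) (A : set T) :
  meager A -> exists C : nat -> set T,
    (forall n, closed (C n) /\ nowhere_dense (C n)) /\ A `<=` \bigcup_n C n.
Proof.
move=> [F nF ->]; exists (fun n => closure (F n)); split.
  by move=> n; split; [exact: closed_closure|exact: nowhere_dense_closure].
by apply: subset_bigcup => n _; exact: subset_closure.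
Qed.

Lemma homeo_nowhere_dense (S T : topologicalType) (h : S -> T) (g : T -> S)
    (C : set T) : continuous h -> continuous g -> cancel h g -> cancel g h ->
  nowhere_dense C -> nowhere_dense (h @^-1` C).
Proof.
move=> ch cg hK gK nC.
apply: (@nowhere_denseS _ _ (h @^-1` closure C)).
  by apply: preimage_subset; exact: subset_closure.
apply: closed_nowhere_dense.
  by apply: (continuous_closedP h).1 ch _ _; exact: closed_closure.
move=> W oW [x Wx] WC.
have gW0 : g @^-1` W = set0.
  apply: nowhere_dense_open nC _ _.
    by apply: open_comp => // x' _; exact: cg.
  by move=> y /= /WC; rewrite /= gK.
have : (g @^-1` W) (h x) by rewrite /= hK.
by rewrite gW0.
Qed.

(** * Baire's theorem for locally compact Hausdorff spaces *)

Lemma compact_locally_compact (T : topologicalType) :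
  compact [set: T] -> locally_compact [set: T].
Proof.
move=> cT x _; rewrite withinET; exists setT; first exact: filterT.
by split=> //; exact: closedT.
Qed.

Lemma locally_compact_regular (T : topologicalType) :
  hausdorff_space T -> locally_compact [set: T] -> regular_space T.
Proof.
move=> hT lT x; have := lT x I; rewrite withinET => -[V nV [cV _]].
exact: (@compact_regular _ x V).
Qed.

Lemma open_shrink (T : topologicalType) (U : set T) (x : T) :
  regular_space T -> open U -> U x ->
  exists V : set T, [/\ open V, V x & closure V `<=` U].
Proof.
move=> rT oU Ux; have [|C nC CU] := rT x U.
  by apply: open_nbhs_nbhs.
exists C°; split => //; first exact: open_interior.
by apply: subset_trans CU; apply: closureS; exact: interior_subset.
Qed.

(** Let O be covered by nowhere dense sets F n. Inside O, build nonempty open sets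
    U n, the first with closure in a compact set, such that the closure of
    U n.+1 lies in U n and misses F n. Points chosen in the U n accumulate by
    compactness, and an accumulation point lies in O but in no F n. *)
Lemma locally_compact_baire (T : topologicalType) (O : set T) :
  hausdorff_space T -> locally_compact [set: T] ->
  open O -> meager O -> O = set0.
Proof.
move=> hT lT oO [F nF OE]; rewrite -subset0 => x Ox.
have rT := locally_compact_regular hT lT.
have := lT x I; rewrite withinET => -[V nV [cV clV]].
have [||U0 [oU0 U0x U0OV]] := @open_shrink _ (O `&` V°) x rT.
- by apply: openI => //; exact: open_interior.
- by split.
(* Each open set comes with a point of it, which witnesses nonemptiness. *)
pose good (p : set T * T) := open p.1 /\ p.1 p.2.
have step (np : nat * {p | good p}) : exists q : {p | good p},
    closure (sval q).1 `<=` (sval np.2).1 `&` ~` F np.1.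
  case: np => n [[U y]/= [oU /= Uy]].
  have [z [Uz Fz]] : exists z, (U `&` ~` closure (F n)) z.
    apply: contrapT => /forallNP noz.
    suff U0' : U = set0 by move: Uy; rewrite U0'.
    apply: nowhere_dense_open (nF n) oU _ => z Uz.
    by apply: contrapT => Fz; exact: (noz z).
  have [||W [oW Wz WU]] := @open_shrink _ (U `&` ~` closure (F n)) z rT.
  - by apply: openI => //; apply/closed_openC/closed_closure.
  - by split.
  exists (exist _ (W, z) (conj oW Wz)) => /=.
  apply: subset_trans WU _; apply: setIS.
  by apply: subsetC; exact: subset_closure.
have [next nextP] := choice step.
pose a := fix a n : {p | good p} := if n is m.+1 then next (m, a m)
  else exist _ (U0, x) (conj oU0 U0x).
pose U n := (sval (a n)).1; pose u n := (sval (a n)).2.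
have US n : closure (U n.+1) `<=` U n `&` ~` F n by exact: nextP (n, a n).
have Uu n : U n (u n) by rewrite /U /u; case: (a n) => p [].
have Udec m n : (n <= m)%N -> U m `<=` U n.
  move=> /subnK <-; elim: (m - n)%N => // k IH y Uy.
  rewrite addSn in Uy.
  by apply: IH; have [] := US _ _ (subset_closure Uy).
have U0V : closure (U 0%N) `<=` O `&` V.
  by apply: subset_trans U0OV _; apply: setIS; exact: interior_subset.
have uV : (u @ \oo) V.
  exists 0%N => // n _ /=; have [] // := U0V (u n).
  by apply: subset_closure; exact: Udec (leq0n n) _ (Uu n).
have [p [_ pcl]] := cV (u @ \oo) _ uV.
have pU n : closure (U n) p.
  move: pcl; rewrite clusterE; apply.
  by exists n => // m /= nm; exact: Udec nm _ (Uu m).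
have [Op _] := U0V _ (pU 0%N).
move: Op; rewrite OE => -[n _ Fp].
by have [_] := US n _ (pU n.+1).
Qed.

(** * The Baire property of Borel sets *)

Definition baire_property (T : topologicalType) (B : set T) :=
  exists U M : set T,
    [/\ open U, meager M & forall x, ~ M x -> (B x <-> U x)].

(** For the complement, the open set [~` U] becomes open by removing the
    boundary of U, which is nowhere dense. *)
Lemma sigma_algebra_baire_property (T : topologicalType) :
  sigma_algebra setT (@baire_property T).
Proof.
split=> [|B [U [M [oU mM BU]]]|B BP].
- by exists set0, set0; split=> //; [exact: open0|exact: meager0].
- exists (~` closure U), (M `|` (closure U `&` ~` U)); split.
  + by apply/closed_openC/closed_closure.
  + apply: meagerU => //; apply/nowhere_dense_meager/closed_nowhere_dense.
      by apply: closedI; [exact: closed_closure|exact: open_closedC].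
    move=> W oW [w Ww] WU; have [clUw _] := WU _ Ww.
    have [|y [Uy Wy]] := clUw W; first exact: open_nbhs_nbhs.
    by have [_] := WU _ Wy.
  + move=> x /not_orP[Mx clUx]; rewrite setTD /= BU//; split.
      by move=> Ux cUx; exact: clUx.
    by move=> cUx Ux; apply: cUx; exact: subset_closure.
- have /choice[U UP] n := BP n; have /choice[M MP] n := UP n.
  exists (\bigcup_n U n), (\bigcup_n M n); split.
  + by apply: bigcup_open => n _; have [] := MP n.
  + by apply: meager_bigcup => n; have [] := MP n.
  + move=> x Mx; have BU n : B n x <-> U n x.
      by have [_ _] := MP n; apply => Mnx; apply: Mx; exists n.
    by split=> -[n _ /BU ?]; exists n.
Qed.

Lemma borel_baire_property (T : topologicalType) (B : set T) :
  borel_set B -> baire_property B.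
Proof.
apply: smallest_sub; first exact: sigma_algebra_baire_property.
by move=> U oU; exists U, set0; split => //; exact: meager0.
Qed.

Lemma closed_borel (T : topologicalType) (C : set T) : closed C -> borel_set C.
Proof.
move=> cC; rewrite -(setCK C) -setTD; apply: sigma_algebraCD.
by apply: sub_sigma_algebra; exact: closed_openC.
Qed.

(** * Metric spaces and their subspaces *)

Lemma compact_metric_dense_sequence (R : realType) (K : metricType R) (k0 : K) :
  compact [set: K] ->
  exists u : nat -> K, forall W : set K, open W -> W !=set0 -> exists n, W (u n).
Proof.
move=> cK.
pose Kp : pseudoPMetricType R :=
  HB.pack (K : Type) (PseudoMetric.on K) (isPointed.Build K k0).
have [B cB [_ basisB]] := @compact_second_countable R Kp cK.
have /countable_injP[i /in2W iinj] := cB.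
(* u n is a point of the basic open set with code n, if there is one. *)
have /choice[u uP] n : exists p : K,
    forall W : set K, B W -> i W = n -> W !=set0 -> W p.
  have [[W [BW iW [p Wp]]]|noW] :=
      pselect (exists W : set K, [/\ B W, i W = n & W !=set0]).
    exists p => W' BW' iW' _; suff -> : W' = W by [].
    by apply: iinj; rewrite ?inE// iW.
  by exists k0 => W BW iW W0; exfalso; apply: noW; exists W.
exists u => W oW [p Wp].
have [|V [BV Vp] VW] := basisB p W; first exact: open_nbhs_nbhs.
by exists (i V); apply: VW; apply: uP BV erefl _; exists p.
Qed.

Lemma metrizable_hausdorff (R : realType) (T : topologicalType)
    (d : T -> T -> R) :
  is_metric d -> metric_induces_topology d -> hausdorff_space T.
Proof.
move=> [dge0 d0 dsym dtri] dT p q pq; apply/d0/eqP.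
rewrite eq_le dge0 andbT leNgt; apply/negP => dpq.
have e0 : 0 < d p q / 2 by rewrite divr_gt0.
have [||y [/= py qy]] := pq [set y | d p y < d p q / 2] [set y | d q y < d p q / 2].
- by apply/dT; exists (d p q / 2).
- by apply/dT; exists (d p q / 2).
have := dtri p y q; rewrite (dsym y q) leNgt => /negP; apply.
by rewrite [ltRHS]splitr ltrD.
Qed.

(** The proof [hd] is a parameter so that the metric structure of the subspace
    can be inferred from its type. A type distinct from [set_type V] is used
    because the latter already carries the topology induced from T. *)
Definition metric_sub (R : realType) (T : choiceType) (d : T -> T -> R)
  (hd : is_metric d) (V : set T) : Type := set_type V.

Section MetricSub.
Context (R : realType) (T : choiceType) (d : T -> T -> R) (hd : is_metric d).
Context (V : set T).

Let dist (x y : metric_sub hd V) : R := d (sval x) (sval y).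

Let dist_xx x : dist x x = 0.
Proof. by have [_ d0 _ _] := hd; exact/d0. Qed.

Let dist_eq0 x y : dist x y = 0 -> x = y.
Proof. by have [_ d0 _ _] := hd; move/d0; exact: val_inj. Qed.

Let dist_sym x y : dist x y = dist y x.
Proof. by have [_ _ dsym _] := hd; exact: dsym. Qed.

Let dist_triangle y x z : dist x z <= dist x y + dist y z.
Proof. by have [_ _ _ dtri] := hd; exact: dtri. Qed.

HB.instance Definition _ := Choice.copy (metric_sub hd V) (set_type V).

HB.instance Definition _ := isMetric.Build R (metric_sub hd V)
  dist_xx dist_eq0 dist_sym dist_triangle.

End MetricSub.

Lemma nbhs_metric_sub (R : realType) (T : topologicalType) (d : T -> T -> R)
    (hd : is_metric d) (V : set T) (k : metric_sub hd V)
    (A : set (metric_sub hd V)) : metric_induces_topology d ->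
  nbhs k A <-> exists2 W : set T, nbhs (sval k) W & sval @^-1` W `<=` A.
Proof.
move=> dT; split=> [/nbhs_ballP[e/= e0 eA]|[W /dT[e e0 eW] WA]].
  exists [set y | d (sval k) y < e]; first by apply/dT; exists e.
  by apply: subset_trans eA => y; rewrite ballEmdist.
apply/nbhs_ballP; exists e => //; apply: subset_trans WA => y.
by rewrite ballEmdist => ?; exact: eW.
Qed.

Lemma metric_sub_continuous (R : realType) (T : topologicalType)
    (d : T -> T -> R) (hd : is_metric d) (V : set T) :
  metric_induces_topology d -> continuous (sval : metric_sub hd V -> T).
Proof. by move=> dT k W kW; apply/nbhs_metric_sub => //; exists W. Qed.

Lemma metric_sub_compact (R : realType) (T : topologicalType)
    (d : T -> T -> R) (hd : is_metric d) (V : set T) :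
  metric_induces_topology d -> compact V -> compact [set: metric_sub hd V].
Proof.
move=> dT cV F FF _.
have [|x [Vx Fx]] := cV (sval @ F) _.
  apply: (@filterS _ F _ setT); last exact: filterT.
  by move=> [x /= /set_mem].
exists (exist _ x (mem_set Vx)); split=> // A B FA /(nbhs_metric_sub _ _ dT)[W xW WB].
have [|_ [[y Ay <-] Wy]] := Fx (sval @` A) W _ xW.
  by apply: (@filterS _ F _ A) FA => y Ay; exists y.
by exists y; split => //; exact: WB.
Qed.

(** A relatively open part of the closure of O meets O itself, so if it lay in
    C, then C would contain a nonempty open set of T. On an arbitrary
    closed subspace in place of the closure of O this may fail: the subspace
    may lie inside C. *)
Lemma nowhere_dense_metric_sub (R : realType) (T : topologicalType)
    (d : T -> T -> R) (hd : is_metric d) (O C : set T) :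
  metric_induces_topology d -> open O -> closed C -> nowhere_dense C ->
  nowhere_dense (sval @^-1` C : set (metric_sub hd (closure O))).
Proof.
move=> dT oO clC nC; apply: closed_nowhere_dense.
  by apply: (continuous_closedP _).1 _ _ clC => k; exact: metric_sub_continuous.
move=> A oA [k Ak] AC.
have /(nbhs_metric_sub _ _ dT)[W kW WA] : nbhs k A by exact: open_nbhs_nbhs.
have WO0 : W° `&` O = set0.
  apply: nowhere_dense_open nC _ _; first exact/openI/oO/open_interior.
  move=> y [/interior_subset Wy Oy]; apply: subset_closure.
  have Oy' := subset_closure Oy.
  by apply: (AC (exist _ y (mem_set Oy'))); exact: WA.
have [y [Oy Wy]] := set_mem (svalP k) _ (nbhs_interior kW).
by rewrite -[False]/(set0 y) -WO0; split.
Qed.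

(** * Haar meager sets *)

Lemma translateE (X : zmodType) (B : set X) (x : X) :
  translate B x = [set y | B (y - x)].
Proof.
apply/seteqP; split=> [_ [b Bb <-]|y By] /=; first by rewrite addrK.
by exists (y - x) => //; rewrite subrK.
Qed.

Lemma subr_continuous (X : topologicalZmodType) (x : X) :
  continuous (fun y : X => y - x).
Proof.
move=> y; apply: (@continuous_comp _ _ _ (fun z => (z, - x))
    (fun p : X * X => p.1 + p.2)); last exact: add_continuous.
by apply: cvg_pair => /=; [exact: cvg_id|exact: cvg_cst].
Qed.

Lemma subrl_continuous (X : topologicalZmodType) (x : X) :
  continuous (fun y : X => x - y).
Proof.
move=> y; apply: (@continuous_comp _ _ _ (fun z => (x, - z))
    (fun p : X * X => p.1 + p.2)); last exact: add_continuous.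
by apply: cvg_pair => /=; [exact: cvg_cst|exact: opp_continuous].
Qed.

Lemma haar_meager_meager (R : realType) (X : topologicalZmodType) (A : set X) :
  hausdorff_space X -> locally_compact [set: X] -> haar_meager R A -> meager A.
Proof.
move=> hX lX [B [bB AB [K [f [[k0 _] cK cf mf]]]]].
apply: meagerS AB _.
have [U [M [oU mM BU]]] := borel_baire_property bB.
have [C [CP MC]] := meager_subset_closed_cover mM.
have [U0|/set0P[u Uu]] := eqVneq U set0.
  apply: meagerS mM => x Bx; apply: contrapT => Mx.
  by have := (BU x Mx).1 Bx; rewrite U0.
exfalso; have [k kdense] := @compact_metric_dense_sequence _ K k0 cK.
(* The x for which some f^-1 (C n + x) contains some k j. *)
pose E := \bigcup_j \bigcup_n (fun x => f (k j) - x) @^-1` C n.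
have mE : meager E.
  apply: meager_bigcup => j; apply: meager_bigcup => n.
  apply: nowhere_dense_meager.
  apply: (@homeo_nowhere_dense _ _ _ (fun x => f (k j) - x)).
  - exact: subrl_continuous.
  - exact: subrl_continuous.
  - by move=> x; rewrite subKr.
  - by move=> x; rewrite subKr.
  - by have [] := CP n.
pose O := (fun x => f k0 - x) @^-1` U.
(* O = f k0 - U is open and nonempty, so Baire's theorem in X applies. *)
have [x [Ox Ex]] : exists x, O x /\ ~ E x.
  apply: contrapT => /forallNP nox.
  have OE : O `<=` E.
    by move=> x Ox; apply: contrapT => Ex; exact: (nox x).
  have O0 : O = set0.
    apply: locally_compact_baire => //; last exact: meagerS mE.
    by apply: open_comp => // ? _; exact: subrl_continuous.
  have : O (f k0 - u) by rewrite /O /= subKr.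
  by rewrite O0.
have cfx : continuous (fun i : K => f i - x).
  move=> i; apply: (@continuous_comp _ _ _ f (fun y => y - x)).
    exact: cf.
  exact: subr_continuous.
pose W := (fun i : K => f i - x) @^-1` U.
suff W0 : W = set0 by have : W k0 by []; rewrite W0.
apply: locally_compact_baire.
- exact: metric_hausdorff.
- exact: compact_locally_compact.
- by apply: open_comp => // ? _; exact: cfx.
apply: (@meagerS _ _ (f @^-1` translate B x `|`
    \bigcup_n (fun i : K => f i - x) @^-1` C n)).
  move=> i Wi; rewrite translateE.
  have [Mi|Mi] := pselect (M (f i - x)); last by left; apply/BU.
  by right; have [n _ Ci] := MC _ Mi; exists n.
apply: meagerU => //; apply: meager_bigcup => n; apply: nowhere_dense_meager.
have [clC nC] := CP n.
apply: closed_nowhere_dense.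
  by apply: (continuous_closedP _).1 _ _ clC => ?; exact: cfx.
move=> V oV V0 VC; have [j Vj] := kdense V oV V0.
by apply: Ex; exists j => //; exists n => //; exact: VC.
Qed.

Lemma meager_haar_meager (R : realType) (X : topologicalZmodType)
    (d : X -> X -> R) (A : set X) :
  is_metric d -> metric_induces_topology d -> locally_compact [set: X] ->
  meager A -> haar_meager R A.
Proof.
move=> hd dT lX /meager_subset_closed_cover[C [CP AC]].
exists (\bigcup_n C n); split => //.
  apply: sigma_algebra_bigcup => n.
  by apply: closed_borel; have [] := CP n.
have := lX 0 I; rewrite withinET => -[V nV [cV clV]].
(* Not V itself, which need not be the closure of its interior. *)
exists (metric_sub hd (closure V°)), sval; split.
- by exists (exist _ 0 (mem_set (subset_closure nV))).
- apply: metric_sub_compact => //; apply: subclosed_compact cV _.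
    exact: closed_closure.
  rewrite [V in _ `<=` V](closure_id V).1//.
  apply: closureS; exact: interior_subset.
- exact: metric_sub_continuous.
- move=> x; rewrite translateE preimage_bigcup.
  apply: meager_bigcup => n; apply: nowhere_dense_meager.
  have [clC nC] := CP n.
  apply: (@nowhere_dense_metric_sub _ _ _ hd _ ((fun y => y - x) @^-1` C n)) => //.
  - exact: open_interior.
  - by apply: (continuous_closedP _).1 _ _ clC => y; exact: subr_continuous.
  - apply: (@homeo_nowhere_dense _ _ _ (fun y => y - (- x))) nC.
    + exact: subr_continuous.
    + exact: subr_continuous.
    + by move=> y; rewrite opprK subrK.
    + by move=> y; rewrite opprK addrK.
Qed.

Theorem corollary2p5 (R : realType) (X : topologicalZmodType)
    (hpolish : polish_space R X) (hlc : locally_compact [set: X])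
    (A : set X) :
  haar_meager R A <-> meager A.
Proof.
have [_ [d [hd dX _]]] := hpolish.
split; last exact: meager_haar_meager hd dX hlc.
exact: haar_meager_meager (metrizable_hausdorff hd dX) hlc.
Qed.
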